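(* Let $C>0$. Let $G=(V,E)$ be a graph with $n:=|V|\sim CM\log M$ (as $M\to\infty$), and let $\Phi$ be an $M\times n$ matrix with columns $\{\varphi_i\}_{i\in V}$ whose entries are drawn independently from $\mathbb{C}\mathcal{N}(0,\frac1M)$. Then for each proportion $\alpha<1-\frac{1}{2C}$ there exists a constant $C'>0$ such that, with overwhelming probability, \[ \max\Big\{\|\varepsilon\|_2,\ \sqrt{M}\,\mathrm{PUN}(\Phi;\alpha,\varepsilon)\Big\}\geq\frac{C'}{\sqrt{M}} \] for every noise vector $\varepsilon=\{\varepsilon_{ij}\}_{\{i,j\}\in E}$ of complex numbers.
   Context: $\mathbb{C}\mathcal{N}(0,\sigma^2)$ is the complex Gaussian with independent $\mathcal{N}(0,\sigma^2/2)$ real and imaginary parts. ''With overwhelming probability'' means with probability at least $1-c_0\mathrm{e}^{-c_1M}$ for constants $c_0,c_1>0$ independent of $M$. Algorithm 1 (pruning for reliability): given a graph $G=(V,E)$, $f:E\to\mathbb{R}$ and $\alpha\in(0,1)$, starting from $H=G$ repeat $\lfloor(1-\alpha)|V|\rfloor$ times: find an edge $\{i,j\}$ of $H$ minimizing $f$ and delete both vertices $i,j$ from $H$. Projective uniformity with noise: for $\alpha\in(0,1)$, $x\in\mathbb{C}^M$ and $\varepsilon$, let $\mathcal{J}(\alpha,x,\varepsilon)$ be the set of vertices remaining after applying Algorithm 1 with $f(i,j)=|\overline{\langle x,\varphi_i\rangle}\langle x,\varphi_j\rangle+\varepsilon_{ij}|$. Then \[ \mathrm{PUN}(\Phi;\alpha,\varepsilon)=\min_{x\in\mathbb{C}^M,\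 \|x\|=1}\ \min_{\{i,j\}\in E,\ i,j\in\mathcal{J}(\alpha,x,\varepsilon)}|\overline{\langle x,\varphi_i\rangle}\langle x,\varphi_j\rangle+\varepsilon_{ij}|. \] *)

(* Defs.v *)
From HB Require Import structures.
From mathcomp Require Import all_boot all_order all_algebra.
From mathcomp Require Import all_classical all_reals all_analysis.
From mathcomp Require Import complex.
Set Implicit Arguments. Unset Strict Implicit. Unset Printing Implicit Defensive.
Import Order.TTheory GRing.Theory Num.Theory.
Local Open Scope classical_set_scope.
Local Open Scope ring_scope.

Section Defs.
Variable R : realType.

Definition cabs (z : R[i]) : R := ComplexField.Normc.normc z.

Definition cinner (M : nat) (x y : 'I_M -> R[i]) : R[i] :=
  \sum_(k < M) x k * conjc (y k).

Definition cnorm (M : nat) (x : 'I_M -> R[i]) : R :=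
  Num.sqrt (\sum_(k < M) cabs (x k) ^+ 2).

(* A simple graph on vertex set 'I_n: symmetric irreflexive relation.
   The edge {i,j} is represented by the ordered pair (i,j) with i < j. *)
Definition simple_graph (n : nat) (e : rel 'I_n) : Prop :=
  (forall i j, e i j = e j i) /\ (forall i, ~~ e i i).

(* One iteration of Algorithm 1 (pruning for reliability) on the current
   vertex set H, with edge weight f (f i j used for the edge {i,j}, i < j):
   pick an edge of H (the induced subgraph) minimizing f and delete both
   endpoints.  If H has no edge left, H is left unchanged (this case cannot
   affect PUN, since no edge can reappear). *)
Definition prune_step (n : nat) (e : rel 'I_n) (f : 'I_n -> 'I_n -> R)
    (H H' : {set 'I_n}) : Prop :=
  (exists i j : 'I_n,
      [/\ (i < j)%N && e i j, i \in H, j \in H,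
          (forall k l : 'I_n, (k < l)%N -> e k l -> k \in H -> l \in H ->
              f i j <= f k l)
        & H' = (H :\ i) :\ j])
  \/ ((forall k l : 'I_n, (k < l)%N -> e k l -> ~ (k \in H /\ l \in H))
      /\ H' = H).

(* prune_run e f k H : H is a possible vertex set after k iterations of
   Algorithm 1 started from H = V (all tie-breaking choices allowed). *)
Inductive prune_run (n : nat) (e : rel 'I_n) (f : 'I_n -> 'I_n -> R) :
    nat -> {set 'I_n} -> Prop :=
  | prune_run0 : prune_run e f 0 ([set: 'I_n])%SET
  | prune_runS k H H' : prune_run e f k H -> prune_step e f H H' ->
      prune_run e f k.+1 H'.

Definition prune_output (n : nat) (e : rel 'I_n) (f : 'I_n -> 'I_n -> R)
    (alpha : R) (J : {set 'I_n}) : Prop :=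
  prune_run e f (Num.truncn ((1 - alpha) * n%:R)) J.

Definition pun_weight (M n : nat) (Phi : 'I_M -> 'I_n -> R[i])
    (x : 'I_M -> R[i]) (eps : 'I_n -> 'I_n -> R[i]) (i j : 'I_n) : R :=
  cabs (conjc (cinner x (fun k => Phi k i)) * cinner x (fun k => Phi k j)
        + eps i j).

(* PUN(Phi; alpha, eps) : the infimum (in the extended reals; +oo over the
   empty set) over unit x, over all runs of Algorithm 1, and over all edges
   with both endpoints remaining, of the weight. *)
Definition PUN (M n : nat) (e : rel 'I_n) (Phi : 'I_M -> 'I_n -> R[i])
    (alpha : R) (eps : 'I_n -> 'I_n -> R[i]) : \bar R :=
  ereal_inf [set r : \bar R | exists (x : 'I_M -> R[i]) (i j : 'I_n)
      (J : {set 'I_n}),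
      [/\ cnorm x = 1, (i < j)%N && e i j,
          prune_output e (pun_weight Phi x eps) alpha J,
          (i \in J) && (j \in J)
        & r = (pun_weight Phi x eps i j)%:E]].

Definition noise_norm (n : nat) (e : rel 'I_n) (eps : 'I_n -> 'I_n -> R[i]) : R :=
  Num.sqrt (\sum_(i < n) \sum_(j < n | (i < j)%N && e i j) cabs (eps i j) ^+ 2).

(* Mutual independence of a finite family of real random variables:
   product rule for all measurable sets (taking B t = setT recovers every
   subfamily). *)
Definition mutually_independent (d : measure_display) (T : measurableType d)
    (P : probability T R) (I : finType) (X : I -> {RV P >-> R}) : Prop :=
  forall B : I -> set R, (forall t, measurable (B t)) ->
    P (\bigcap_t (X t @^-1` B t)) = (\prod_(t : I) P (X t @^-1` B t))%E.

(* X has law N(m, s^2) (s = standard deviation) *)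
Definition normal_law (d : measure_display) (T : measurableType d)
    (P : probability T R) (X : {RV P >-> R}) (m s : R) : Prop :=
  forall B : set R, measurable B -> P (X @^-1` B) = normal_prob m s B.

Definition cmatrix_of (d : measure_display) (T : measurableType d)
    (P : probability T R) (M n : nat)
    (X : 'I_M * 'I_n * bool -> {RV P >-> R}) (w : T) : 'I_M -> 'I_n -> R[i] :=
  fun k i => Complex (X (k, i, false) w) (X (k, i, true) w).

(* Phi has i.i.d. CN(0, 1/M) entries: real and imaginary parts are 2Mn
   mutually independent N(0, 1/(2M)) real random variables *)
Definition complex_gaussian_iid (d : measure_display) (T : measurableType d)
    (P : probability T R) (M n : nat)
    (X : 'I_M * 'I_n * bool -> {RV P >-> R}) : Prop :=
  mutually_independent X /\
  (forall t, normal_law (X t) 0 (Num.sqrt (1 / (2 * M%:R)))).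

End Defs.

(* Main.v *)
(* Suppose that some unit vector x leaves an edge of weight below C'/M after
   k = floor ((1 - alpha) n) pruning steps.  Each pruned edge was at least as
   light, so k disjoint edges have weight below C'/M.  If ||eps|| < C'/sqrt M,
   at most M of them carry noise above C'/M; each of the others has an endpoint
   j with |<x, phi_j>|^2 <= 2 C'/M.  So at least m := k - M columns, a positive
   proportion of all n ~ C M log M, satisfy |Re <x, phi_j>| <= c/sqrt M, where
   c^2 = 2 C'.

   For a fixed vector, Re <x, phi_j> is a centred Gaussian of standard deviation
   of order 1/sqrt M, so independence and a union bound over the subsets of the
   columns bound the probability of this by 2^n (8 c)^m.  Since m is of order
   M log M, for c small this beats the (16 M^2 + 1)^(2 M) points of a coordinate
   grid of mesh 1/(8 M^2), which approximates every unit x well enough as soon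
   as all entries of Phi are at most 1 in modulus. *)
Require Import Defs.
From HB Require Import structures.
From mathcomp Require Import all_boot all_order all_algebra.
From mathcomp Require Import all_classical all_reals all_analysis.
From mathcomp Require Import complex.
From mathcomp Require Import measurable_realfun ring lra.
Set Implicit Arguments.
Unset Strict Implicit.
Unset Printing Implicit Defensive.
Import Order.TTheory GRing.Theory Num.Theory numFieldNormedType.Exports.
Local Open Scope classical_set_scope.
Local Open Scope ring_scope.

(** * Gaussian laws *)

Section NormalLaw.
Context {R : realType}.
Implicit Types (m s a v z : R) (B : set R).
Local Notation mu := (@lebesgue_measure R).

(** Translation preserves the length of half-open intervals, and these determine Lebesgue
    measure. *)
Lemma lebesgue_measureD a B : measurable B ->
  pushforward mu (+%R^~ a : measurableTypeR R -> measurableTypeR R) B = mu B.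
Proof.
move=> mB; pose sh : measurableTypeR R -> measurableTypeR R := +%R^~ a.
have ma : measurable_fun setT sh by exact: measurable_funD.
apply/esym/(lebesgue_measure_unique (mu := pushforward mu sh)) => //=.
move=> _ [[b c]] _ <-.
rewrite /pushforward (_ : sh @^-1` _ = `]b - a, c - a]%classic).
  rewrite /= !lebesgue_measure_itv/= !lte_fin ltrD2r; case: ifP => // _.
  by rewrite -!EFinD opprB addrA subrK.
by apply/seteqP; split => x /=; rewrite !in_itv/= ltrBlDr lerBrDr.
Qed.

Lemma normal_prob_shift m s a B : s != 0 -> measurable B ->
  normal_prob m s (+%R^~ a @^-1` B) = normal_prob (m + a) s B.
Proof.
move=> s0 mB; rewrite /normal_prob.
pose sh : measurableTypeR R -> measurableTypeR R := +%R^~ a.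
have ma : measurable_fun setT sh by exact: measurable_funD.
transitivity (\int[pushforward mu sh]_(x in B) (normal_pdf (m + a) s x)%:E)%E.
  rewrite ge0_integral_pushforward//=; last 2 first.
  - apply/measurable_funTS/measurable_EFinP; exact: measurable_normal_pdf.
  - by move=> y _; rewrite lee_fin normal_pdf_ge0.
  apply: eq_integral => x _ /=; congr EFin.
  by rewrite !normal_pdfE// /normal_fun /sh opprD addrACA subrr addr0.
apply: eq_measure_integral => //= A mA AB; exact: lebesgue_measureD.
Qed.

(** The density [normal_pdf] agrees almost everywhere with the Radon-Nikodym derivative, so the
    general change of variables applies. *)
Lemma integral_normal_prob m s (f : R -> \bar R) : measurable_fun setT f ->
  (\int[normal_prob m s]_x `|f x| < +oo)%E ->
  (\int[normal_prob m s]_x f x = \int[mu]_x (f x * (normal_pdf m s x)%:E))%E.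
Proof.
move=> mf finf.
rewrite -(Radon_Nikodym_change_of_variables (normal_prob_dominates m s))//=;
  last first.
  by apply/integrableP; split.
apply: ae_eq_integral => //.
- apply: emeasurable_funM => //; apply: (measurable_int mu).
  apply: (integrableS _ _ (@subsetT _ _)) => //=.
  by apply: Radon_Nikodym_integrable; exact: normal_prob_dominates.
- apply: emeasurable_funM => //=; apply/measurableT_comp => //=.
  by apply/measurable_funTS; exact: measurable_normal_pdf.
- apply: ae_eqe_mul2l => /=.
  rewrite Radon_NikodymE//=; first exact: normal_prob_dominates.
  move=> abmu.
  case: cid => /= h [h1 h2 h3].
  apply: integral_ae_eq => //=.
  + by apply/measurable_funTS/measurableT_comp =>//; exact: measurable_normal_pdf.
  + by move=> E E01 mE; rewrite -h3.
Qed.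

(** Density of [z] given [v] times density of [v], rewritten as the marginal density of [z] times
    the density of [v] given [z]. Only the last factor depends on [v], and it integrates to 1. *)
Lemma normal_pdf_complete_square (t s a v z : R) : 0 < t -> 0 < s ->
  let S := Num.sqrt (t ^+ 2 + a ^+ 2 * s ^+ 2) in
  normal_pdf (a * v) t z * normal_pdf 0 s v =
  normal_pdf 0 S z * normal_pdf (a * s ^+ 2 * z / S ^+ 2) (t * s / S) v.
Proof.
move=> t0 s0 S.
have S2 : S ^+ 2 = t ^+ 2 + a ^+ 2 * s ^+ 2.
  by rewrite sqr_sqrtr// addr_ge0 ?sqr_ge0// mulr_ge0 ?sqr_ge0.
have S0 : 0 < S by rewrite sqrtr_gt0 ltr_pwDl ?exprn_gt0// mulr_ge0 ?sqr_ge0.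
have ts0 : 0 < t * s / S by rewrite divr_gt0 ?mulr_gt0.
rewrite !normal_pdfE ?gt_eqF// mulrACA [RHS]mulrACA; congr (_ * _).
  have peak0 (x : R) : 0 <= x ^+ 2 * pi *+ 2.
    by rewrite mulrn_wge0// mulr_ge0 ?pi_ge0 ?sqr_ge0.
  rewrite /normal_peak -!invfM -!sqrtrM//.
  by congr (Num.sqrt _)^-1; field; rewrite gt_eqF.
rewrite /normal_fun -!expRD; congr expR.
rewrite expr_div_n exprMn S2.
have ne : t ^+ 2 + a ^+ 2 * s ^+ 2 != 0 by rewrite -S2 sqrf_eq0 gt_eqF.
by field; rewrite exprMn ne !gt_eqF.
Qed.

Lemma measurable_normal_pdf_mean (t a : R) : 0 < t ->
  measurable_fun setT (fun p : R * R => normal_pdf (a * p.1) t p.2).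
Proof.
move=> t0; rewrite (_ : (fun _ => _) = fun p : R * R =>
   normal_peak t * expR (- (p.2 - a * p.1) ^+ 2 / (t ^+ 2 *+ 2))); last first.
  by apply/funext => p; rewrite normal_pdfE ?gt_eqF.
apply: measurable_funM => //; apply: measurableT_comp => //.
apply: measurable_funM => //; apply: measurableT_comp => //.
apply: measurable_funX; apply: measurable_funB => //.
exact: measurable_funM.
Qed.

(** Tonelli moves the integral over [v] inside; after completing the square it is the total mass of
    a normal density. *)
Lemma normal_prob_convolution (t s a : R) B : 0 < t -> 0 < s -> measurable B ->
  (\int[normal_prob 0 s]_v normal_prob (a * v) t B)%E =
  normal_prob 0 (Num.sqrt (t ^+ 2 + a ^+ 2 * s ^+ 2)) B.
Proof.
move=> t0 s0 mB; set S := Num.sqrt _.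
pose F (p : R * R) := (normal_pdf (a * p.1) t p.2 * \1_B p.2)%:E.
have mF : measurable_fun setT F.
  apply/measurable_EFinP; apply: measurable_funM.
    exact: measurable_normal_pdf_mean.
  by apply: measurableT_comp => //; exact: measurable_indic.
have F0 p : (0 <= F p)%E by rewrite lee_fin mulr_ge0 ?normal_pdf_ge0.
have FE v : normal_prob (a * v) t B = fubini_F mu F v.
  rewrite /normal_prob integral_mkcond /fubini_F; apply: eq_integral => z _.
  by rewrite epatch_indic /= -EFinM.
have mFF := measurable_fun_fubini_tonelli_F (m2 := mu) F mF F0.
rewrite integral_normal_prob; last 2 first.
- by rewrite (_ : (fun _ => _) = fubini_F mu F)//; apply/funext.
- apply: (@le_lt_trans _ _ (\int[normal_prob 0 s]_x (cst 1%E x))%E); last first.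
    by rewrite integral_cst//= probability_setT mule1 ltry.
  apply: ge0_le_integral => //=.
  + apply: measurableT_comp => //.
    by rewrite (_ : (fun _ => _) = fubini_F mu F)//; apply/funext.
  + by move=> x _; rewrite gee0_abs//; exact: probability_le1.
transitivity (\int[mu]_v \int[mu]_z (F (v, z) * (normal_pdf 0 s v)%:E))%E.
  apply: eq_integral => v _; rewrite FE /fubini_F ge0_integralZr//=.
  - exact: (measurableT_comp mF).
  - by rewrite lee_fin normal_pdf_ge0.
pose G (p : R * R) := (F p * (normal_pdf 0 s p.1)%:E)%E.
have mG : measurable_fun setT G.
  apply: emeasurable_funM => //; apply/measurable_EFinP.
  exact: (measurableT_comp (measurable_normal_pdf 0 s)).
have G0 p : (0 <= G p)%E by rewrite mule_ge0// lee_fin normal_pdf_ge0.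
transitivity (\int[mu]_z \int[mu]_v G (v, z))%E.
  exact: (fubini_tonelli (m1 := mu) (m2 := mu) G mG G0).
rewrite [RHS]/normal_prob [RHS]integral_mkcond; apply: eq_integral => z _.
rewrite epatch_indic/=.
transitivity (\int[mu]_x ((normal_pdf 0 S z * \1_B z)%:E *
   (normal_pdf (a * s ^+ 2 * z / S ^+ 2) (t * s / S) x)%:E))%E.
  apply: eq_integral => v _; rewrite /G /F/= -!EFinM; congr EFin.
  by rewrite mulrAC normal_pdf_complete_square// mulrAC.
rewrite ge0_integralZl//=.
- by rewrite integral_normal_pdf mule1.
- apply/measurable_EFinP; exact: measurable_normal_pdf.
- by move=> x _; rewrite lee_fin normal_pdf_ge0.
- by rewrite lee_fin mulr_ge0 ?normal_pdf_ge0.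
Qed.

End NormalLaw.

(** * Joint law and sum of two independent Gaussian variables *)

Section IndependentSum.
Context {R : realType} d (T : measurableType d) (P : probability T R).
Implicit Types (U V : T -> R) (E : set T) (s t a : R).
Local Open Scope ereal_scope.

(** Conditionally on [E], the law of the pair is a product on rectangles, and a product measure is
    determined by its rectangles. *)
Lemma independent_pair_law d1 d2 (T1 : measurableType d1)
    (T2 : measurableType d2) (m1 : probability T1 R) (m2 : probability T2 R)
    (U : T -> T1) (V : T -> T2) E :
  measurable_fun setT U -> measurable_fun setT V -> measurable E ->
  (forall A B, measurable A -> measurable B ->
    P (U @^-1` A `&` V @^-1` B `&` E) = m1 A * m2 B * P E) ->
  forall D, measurable D ->
    P ((fun w => (U w, V w)) @^-1` D `&` E) = (m1 \x m2) D * P E.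
Proof.
move=> mU mV mE UVE D mD.
pose W w := (U w, V w).
have mW : measurable_fun setT W by exact/measurable_fun_pairP.
have mWD : measurable (W @^-1` D) by rewrite -[X in measurable X]setTI; exact: mW.
have PEfin : P E \is a fin_num by exact: fin_num_measure.
(* Conditioning divides by [P E]; if [P E] is 0, both sides vanish. *)
have [PE0|PE0] := eqVneq (P E) 0.
  rewrite PE0 mule0; apply/eqP; rewrite eq_le measure_ge0 andbT -PE0.
  by apply: le_measure; rewrite ?inE//; exact: measurableI.
have c0 : (0 <= (fine (P E))^-1)%R by rewrite invr_ge0 fine_ge0.
have PEV (x : \bar R) : x * P E * ((fine (P E))^-1)%:E = x.
  rewrite -muleA -[X in X * _%:E]fineK// -EFinM divff ?mule1//.
  by rewrite fine_eq0.
(* [nu] is the conditional probability given [E]. *)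
pose nu : {measure set T -> \bar R} := mscale (NngNum c0) (mrestr P mE).
have nuE A : nu A = P (A `&` E) * ((fine (P E))^-1)%:E by rewrite muleC.
rewrite (product_measure_unique (m' := pushforward nu W))//.
  transitivity (P (W @^-1` D `&` E) * ((fine (P E))^-1)%:E * P E).
    by rewrite muleAC PEV.
  by rewrite -nuE.
by move=> A B mA mB; rewrite [LHS]nuE (UVE A B) ?PEV.
Qed.

(** For fixed [V = v], the event says that [U] lies in a translate of [B] by [- a v]; integrating
    over [v] gives the convolution. *)
Lemma normal_sum_law U V E t s a : measurable_fun setT U ->
  measurable_fun setT V -> measurable E -> (0 < t)%R -> (0 < s)%R ->
  (forall A B : set R, measurable A -> measurable B ->
    P (U @^-1` A `&` V @^-1` B `&` E) =
    normal_prob 0 t A * normal_prob 0 s B * P E) ->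
  forall B : set R, measurable B ->
    P ((fun w => U w + a * V w)%R @^-1` B `&` E) =
    normal_prob 0 (Num.sqrt (t ^+ 2 + a ^+ 2 * s ^+ 2)) B * P E.
Proof.
move=> mU mV mE t0 s0 UVE B mB.
pose D : set (R * R) := (fun p => p.2 + a * p.1)%R @^-1` B.
have mD : measurable D.
  rewrite -[D]setTI; apply: (_ : measurable_fun setT _) => //.
  by apply: measurable_funD => //; exact: measurable_funM.
have VUE (A A' : set (measurableTypeR R)) : measurable A -> measurable A' ->
    P (V @^-1` A `&` U @^-1` A' `&` E) =
    normal_prob 0 s A * normal_prob 0 t A' * P E.
  move=> mA mA'; rewrite (setIC (V @^-1` A) (U @^-1` A')) (UVE A' A mA' mA).
  exact: (congr1 (fun x => x * P E) (muleC _ _)).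
have -> : (fun w => U w + a * V w)%R @^-1` B = (fun w => (V w, U w)) @^-1` D by [].
rewrite (@independent_pair_law _ _ (measurableTypeR R) (measurableTypeR R)
  (normal_prob 0 s) (normal_prob 0 t) V U E mV mU mE VUE D mD).
apply: (congr1 (fun x => x * P E)).
rewrite -(normal_prob_convolution a t0 s0 mB) /product_measure1.
apply: eq_integral => v _.
rewrite -[(a * v)%R]add0r -normal_prob_shift ?gt_eqF//; congr normal_prob.
by apply/seteqP; split => u /=; rewrite /xsection /= inE.
Qed.

End IndependentSum.

(** * Linear combinations along independent columns *)

Section GaussianColumns.
Context {R : realType} d (T : measurableType d) (P : probability T R).
Implicit Types (U V : T -> R) (E : set T) (s t a : R).
Local Open Scope ereal_scope.

Definition all_in (K : eqType) (ks : seq K) (X : K -> T -> R)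
    (B : K -> set R) : set T :=
  [set w | forall k, k \in ks -> B k (X k w)].

Lemma all_in_nil (K : eqType) (X : K -> T -> R) B : all_in [::] X B = setT.
Proof. by apply/seteqP; split. Qed.

Lemma all_in_cons (K : eqType) k ks (X : K -> T -> R) B :
  all_in (k :: ks) X B = X k @^-1` B k `&` all_in ks X B.
Proof.
apply/seteqP; split => w /=.
  move=> h; split; first by apply: h; rewrite mem_head.
  by move=> i iks; apply: h; rewrite inE iks orbT.
by move=> [h1 h2] i; rewrite inE => /orP[/eqP ->|/h2].
Qed.

Lemma eq_all_in (K : eqType) ks (X : K -> T -> R) B B' :
  {in ks, B =1 B'} -> all_in ks X B = all_in ks X B'.
Proof.
by move=> BB'; apply/seteqP; split => w h k kks; have := h k kks; rewrite BB'.
Qed.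

Lemma measurable_all_in (K : eqType) ks (X : K -> T -> R) B :
  (forall k, measurable_fun setT (X k)) -> (forall k, measurable (B k)) ->
  measurable (all_in ks X B).
Proof.
move=> mX mB; elim: ks => [|k ks IH]; first by rewrite all_in_nil.
rewrite all_in_cons; apply: measurableI => //.
by rewrite -[X in measurable X]setTI; exact: mX.
Qed.

(* The arbitrary event [E] stands for the variables that are not summed. *)
Lemma normal_linear_comb_law (K : eqType) (X : K -> T -> R) (y : K -> R)
    s ks U t E :
  (0 < s)%R -> (forall k, measurable_fun setT (X k)) ->
  uniq ks -> (0 < t)%R -> measurable_fun setT U -> measurable E ->
  (forall A B, measurable A -> (forall k, measurable (B k)) ->
    P (U @^-1` A `&` all_in ks X B `&` E) =
    normal_prob 0 t A * \prod_(k <- ks) normal_prob 0 s (B k) * P E) ->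
  forall B : set R, measurable B ->
    P ((fun w => U w + \sum_(k <- ks) y k * X k w)%R @^-1` B `&` E) =
    normal_prob 0 (Num.sqrt (t ^+ 2 + \sum_(k <- ks) y k ^+ 2 * s ^+ 2)) B * P E.
Proof.
move=> s0 mX; elim: ks U t => [|k ks IH] U t.
  move=> _ t0 mU mE hyp B mB; rewrite big_nil addr0 sqrtr_sqr gtr0_norm//.
  under eq_fun do rewrite big_nil addr0.
  have := hyp B (fun=> setT) mB (fun=> measurableT).
  by rewrite all_in_nil setIT big_nil mule1.
move=> /= /andP[kks uks] t0 mU mE hyp B mB.
have S0 : (0 <= y k ^+ 2 * s ^+ 2)%R by rewrite mulr_ge0 ?sqr_ge0.
have h1 A A' B' : measurable A -> measurable A' -> (forall k, measurable (B' k)) ->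
    P (U @^-1` A `&` X k @^-1` A' `&` (all_in ks X B' `&` E)) =
    normal_prob 0 t A * normal_prob 0 s A' *
    (\prod_(i <- ks) normal_prob 0 s (B' i) * P E).
  move=> mA mA' mB'.
  (* The condition on [X k] is put back among the conditions on the list, so that [hyp] applies. *)
  pose B'' i := if i == k then A' else B' i.
  have mB'' i : measurable (B'' i) by rewrite /B''; case: ifP.
  have := hyp A B'' mA mB''; rewrite all_in_cons big_cons /B'' eqxx.
  have ne i : i \in ks -> (i == k) = false.
    by move=> iks; apply/negP => /eqP ik; move: kks; rewrite -ik iks.
  rewrite (@eq_all_in _ _ _ _ B'); last by move=> i /ne ->.
  rewrite (eq_big_seq (fun i => normal_prob 0 s (B' i))); last by move=> i /ne ->.
  by rewrite !setIA !muleA.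
have h2 B' : (forall k, measurable (B' k)) ->
    P (all_in ks X B' `&` E) = \prod_(i <- ks) normal_prob 0 s (B' i) * P E.
  move=> mB'; have := h1 setT setT B' measurableT measurableT mB'.
  by rewrite !preimage_setT !setTI !probability_setT !mul1e.
under eq_fun do rewrite big_cons addrA.
rewrite big_cons addrA -[(t ^+ 2 + _)%R]sqr_sqrtr; last first.
  by rewrite addr_ge0 ?sqr_ge0.
(* The term of index [k] joins the accumulator [U], and its variance joins [t ^+ 2]; the events on
   the remaining indices go into the conditioning event of [normal_sum_law]. *)
apply: (IH (fun w => U w + y k * X k w)%R) => //.
- by rewrite sqrtr_gt0 ltr_pwDl// exprn_gt0.
- by apply: measurable_funD => //; exact: measurable_funM.
move=> A B' mA mB'; rewrite -setIA -muleA -h2//.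
apply: normal_sum_law => //.
  by apply: measurableI => //; exact: measurable_all_in.
by move=> A1 A2 mA1 mA2; rewrite h1// h2.
Qed.

Section Columns.
(* One coefficient is normalised to 1, so that the law of each column sum is
   nondegenerate whatever the other coefficients are. *)
Context (K : finType) (J : eqType) (X : K -> J -> T -> R).
Context (k0 : K) (y : K -> R) (s : R).
Hypotheses (s0 : (0 < s)%R) (mX : forall k j, measurable_fun setT (X k j)).

Let Y j w := (X k0 j w + \sum_(k | k != k0) y k * X k j w)%R.
Let S := Num.sqrt (s ^+ 2 + \sum_(k | k != k0) y k ^+ 2 * s ^+ 2).

Let mY j : measurable_fun setT (Y j).
Proof.
apply: measurable_funD => //; under eq_fun do rewrite -big_filter.
by apply: measurable_sum => k; exact: measurable_funM.
Qed.

Definition all_cols (js : seq J) (B : J -> K -> set R) : set T :=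
  [set w | forall j, j \in js -> forall k, B j k (X k j w)].

Lemma all_cols_cons j js B :
  all_cols (j :: js) B = all_in (index_enum K) (X ^~ j) (B j) `&` all_cols js B.
Proof.
apply/seteqP; split => w /=.
  move=> h; split; first by move=> k _; apply: h; rewrite mem_head.
  by move=> i iks; apply: h; rewrite inE iks orbT.
move=> [h1 h2] i; rewrite inE => /orP[/eqP ->|/h2//] k; apply: h1.
by rewrite mem_index_enum.
Qed.

Lemma measurable_all_cols js B : (forall j k, measurable (B j k)) ->
  measurable (all_cols js B).
Proof.
move=> mB; elim: js => [|j js IH].
  by rewrite (_ : all_cols _ _ = setT)//; apply/seteqP; split.
by rewrite all_cols_cons; apply: measurableI => //; exact: measurable_all_in.
Qed.

(** Induction on the columns: the sum of column [j] is handled with the entries of the other columns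
    inside the conditioning event. The event on this sum then becomes part of [E] for the rest of
    the list. *)
Lemma normal_columns_law js E : uniq js -> measurable E ->
  (forall B, (forall j k, measurable (B j k)) ->
    P (all_cols js B `&` E) =
    \prod_(j <- js) \prod_k normal_prob 0 s (B j k) * P E) ->
  forall D, (forall j, measurable (D j)) ->
    P (all_in js Y D `&` E) = \prod_(j <- js) normal_prob 0 S (D j) * P E.
Proof.
elim: js E => [|j js IH] E.
  by move=> _ _ _ D _; rewrite all_in_nil setTI big_nil mul1e.
move=> /= /andP[jjs ujs] mE hyp D mD.
have h1 C B : (forall k, measurable (C k)) -> (forall j k, measurable (B j k)) ->
    P (all_in (index_enum K) (X ^~ j) C `&` (all_cols js B `&` E)) =
    \prod_k normal_prob 0 s (C k) *
    (\prod_(j <- js) \prod_k normal_prob 0 s (B j k) * P E).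
  move=> mC mB.
  pose B'' i := if i == j then C else B i.
  have mB'' i k : measurable (B'' i k) by rewrite /B''; case: ifP.
  have := hyp B'' mB''; rewrite all_cols_cons big_cons /B'' eqxx.
  have ne i : i \in js -> (i == j) = false.
    by move=> iks; apply/negP => /eqP ik; move: jjs; rewrite -ik iks.
  rewrite (_ : all_cols js _ = all_cols js B); last first.
    by apply/seteqP; split => w h i ijs k; have := h i ijs k; rewrite ne.
  rewrite (eq_big_seq (fun i => \prod_k normal_prob 0 s (B i k))); last first.
    by move=> i /ne ->.
  by rewrite !setIA !muleA.
have h2 B : (forall j k, measurable (B j k)) ->
    P (all_cols js B `&` E) = \prod_(j <- js) \prod_k normal_prob 0 s (B j k) * P E.
  move=> mB; have := h1 (fun=> setT) B (fun=> measurableT) mB.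
  rewrite (_ : all_in _ _ _ = setT); last by apply/seteqP; split.
  by rewrite setTI big1 ?mul1e// => k _; rewrite probability_setT.
have h3 B : (forall j k, measurable (B j k)) ->
    P (Y j @^-1` D j `&` (all_cols js B `&` E)) =
    normal_prob 0 S (D j) * P (all_cols js B `&` E).
  move=> mB.
  pose ks := [seq k <- index_enum K | k != k0].
  have -> : Y j = (fun w => X k0 j w + \sum_(k <- ks) y k * X k j w)%R.
    by apply/funext => w; rewrite /Y big_filter.
  rewrite /S -big_filter -/ks.
  apply: (normal_linear_comb_law (X := X ^~ j)) => //.
  - by rewrite filter_uniq// index_enum_uniq.
  - by apply: measurableI => //; exact: measurable_all_cols.
  move=> A C mA mC.
  (* The entry of index [k0] serves as the starting accumulator, so its event [A] takes the place of
     [C k0]. *)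
  pose C' k := if k == k0 then A else C k.
  have mC' i : measurable (C' i) by rewrite /C'; case: ifP.
  rewrite h2// big_filter.
  have := h1 C' B mC' mB.
  rewrite (bigD1 k0)//= {2}/C' eqxx.
  rewrite (eq_bigr (fun k => normal_prob 0 s (C k))); last first.
    by move=> k kk0; rewrite /C' (negbTE kk0).
  move=> <-; congr (P (_ `&` _)); apply/seteqP; split => w /=.
    move=> [Aw h] k _; rewrite /C'; case: eqVneq => [->//|kk0]; apply: h.
    by rewrite mem_filter kk0 mem_index_enum.
  move=> h; split.
    by have := h k0; rewrite /C' eqxx; apply; rewrite mem_index_enum.
  move=> k; rewrite mem_filter => /andP[kk0 kK].
  by have := h k kK; rewrite /C' (negbTE kk0).
have h4 : P (Y j @^-1` D j `&` E) = normal_prob 0 S (D j) * P E.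
  have := h3 (fun _ _ => setT) (fun _ _ => measurableT).
  by rewrite (_ : all_cols _ _ = setT) ?setTI//; apply/seteqP; split.
rewrite all_in_cons (setIC (Y j @^-1` _)) -setIA IH//.
- by rewrite h4 big_cons muleCA muleA.
- by apply: measurableI => //; rewrite -[X in measurable X]setTI; exact: mY.
- by move=> B mB; rewrite setICA h3// h2// h4 muleCA.
Qed.

End Columns.
End GaussianColumns.

(** * Small-ball and tail bounds for the normal law *)

Section NormalBounds.
Context {R : realType}.
Implicit Types r s : R.
Local Notation mu := (@lebesgue_measure R).

(** The interval has length [2 r], and the density peaks at [1 / (s sqrt (2 pi))], at most
    [1 / (2 s)] because [pi >= 2]. *)
Lemma normal_prob_ball r s : 0 < s -> 0 <= r ->
  (normal_prob 0 s `[(- r)%R, r]%classic <= (r / s)%:E)%E.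
Proof.
move=> s0 r0; have sn0 : s != 0 by rewrite gt_eqF.
apply: (@le_trans _ _ (\int[mu]_(x in `[(- r)%R, r]) (normal_peak s)%:E)%E).
  apply: ge0_le_integral => //=.
  - by move=> x _; rewrite lee_fin normal_pdf_ge0.
  - apply/measurable_funTS/measurable_EFinP; exact: measurable_normal_pdf.
  - by move=> x _; rewrite lee_fin normal_pdf_ub.
rewrite integral_cst//= lebesgue_measure_itv/=.
have le0 : (0 <= (r / s)%:E :> \bar R)%E by rewrite lee_fin divr_ge0// ltW.
case: ifP => _; last by rewrite mule0.
rewrite -EFinD -EFinM lee_fin opprK.
have peak_le : normal_peak s <= (s * 2)^-1.
  rewrite lef_pV2 ?posrE ?mulr_gt0//; last first.
    by rewrite sqrtr_gt0 mulrn_wgt0// mulr_gt0 ?pi_gt0 ?exprn_gt0.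
  have s20 : 0 <= s * 2 by rewrite mulr_ge0// ltW.
  rewrite -(ger0_norm s20) -sqrtr_sqr ler_wsqrtr//.
  by rewrite exprMn -mulrnAr ler_wpM2l ?sqr_ge0// expr2 mulr_natr lerMn2r pi_ge2.
apply: (le_trans (ler_wpM2r _ peak_le)); first by rewrite addr_ge0.
by rewrite le_eqVlt; apply/orP; left; apply/eqP; field.
Qed.

Lemma measurable_norm_gt1 : measurable [set x : R | 1 < `|x|]%R.
Proof.
rewrite (_ : [set _ | _] = (@Num.norm R R) @^-1` `]1, +oo[%classic).
  by rewrite -[X in measurable X]setTI; exact: normr_measurable.
by apply/seteqP; split => x /=; rewrite in_itv/= andbT.
Qed.

(* On [1 < |x|] the density of N(0, s^2) is at most [2 exp (- 3 / (8 s^2))]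
   times that of N(0, (2 s)^2). *)
Lemma normal_prob_tail s : 0 < s ->
  (normal_prob 0 s [set x : R | 1 < `|x|]%R <= (2 * expR (- (3 / (8 * s ^+ 2))))%:E)%E.
Proof.
move=> s0; have sn0 : s != 0 by rewrite gt_eqF.
have s2n0 : 2 * s != 0 by rewrite gt_eqF// mulr_gt0.
set k := 2 * _; have k0 : 0 <= k by rewrite mulr_ge0 ?expR_ge0.
have mt := measurable_norm_gt1.
have pdf_le x : 1 < `|x| -> normal_pdf 0 s x <= k * normal_pdf 0 (2 * s) x.
  move=> x1; rewrite !normal_pdfE//.
  have -> : normal_peak s = 2 * normal_peak (2 * s).
    rewrite /normal_peak.
    have -> : (2 * s) ^+ 2 * pi *+ 2 = 2 ^+ 2 * (s ^+ 2 * pi *+ 2) :> R by ring.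
    by rewrite sqrtrM ?sqr_ge0// sqrtr_sqr ger0_norm// invfM mulrA divff ?mul1r.
  rewrite /k -!mulrA ler_wpM2l// mulrCA ler_wpM2l ?normal_peak_ge0//.
  rewrite /normal_fun -expRD ler_expR !subr0.
  have x2 : 1 <= x ^+ 2 by rewrite -real_normK ?num_real// exprn_ege1// ltW.
  have -> : - x ^+ 2 / (s ^+ 2 *+ 2) =
    - (3 / (8 * s ^+ 2)) * x ^+ 2 + - x ^+ 2 / ((2 * s) ^+ 2 *+ 2) by field.
  rewrite lerD2r -[leRHS]mulr1 ler_wnM2l// oppr_le0 divr_ge0// mulr_ge0//.
  by rewrite sqr_ge0.
apply: (@le_trans _ _ (\int[mu]_(x in [set x | (1 < `|x|)%R])
    (k%:E * (normal_pdf 0 (2 * s) x)%:E))%E).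
  apply: ge0_le_integral => //=.
  - by move=> x _; rewrite lee_fin normal_pdf_ge0.
  - apply/measurable_funTS/measurable_EFinP; exact: measurable_normal_pdf.
  - apply/measurable_funTS/measurable_EFinP/measurable_funM => //.
    exact: measurable_normal_pdf.
rewrite ge0_integralZl//=.
- rewrite -[leRHS]mule1 lee_wpmul2l//.
  rewrite -[X in (X <= _)%E]/(normal_prob 0 (2 * s) _); exact: probability_le1.
- apply/measurable_funTS/measurable_EFinP; exact: measurable_normal_pdf.
- by move=> x _; rewrite lee_fin normal_pdf_ge0.
Qed.

End NormalBounds.

(** * Finite union bound *)

Section UnionBound.
Context {R : realType} d (T : measurableType d) (P : probability T R).

Lemma union_bound (I : Type) (r : seq I) (Q : pred I) (F : I -> set T) (c : R) :
  0 <= c -> (forall i, measurable (F i)) ->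
  (forall i, Q i -> (P (F i) <= c%:E)%E) ->
  (P (\big[setU/set0]_(i <- r | Q i) F i) <= ((size r)%:R * c)%:E)%E.
Proof.
move=> c0 mF Fc; elim: r => [|i r IH].
  by rewrite big_nil measure0 mul0r.
rewrite big_cons; case: ifP => Qi /=; last first.
  by apply: (le_trans IH); rewrite lee_fin ler_wpM2r// ler_nat.
have mr : measurable (\big[setU/set0]_(j <- r | Q j) F j).
  exact: bigsetU_measurable.
rewrite (le_trans (measureU2 P (mF i) mr))//.
by rewrite -nat1r mulrDl mul1r EFinD leeD// Fc.
Qed.

End UnionBound.

(** * Simultaneously small column sums *)

Section ColumnSmallBall.
Context {R : realType} d (T : measurableType d) (P : probability T R).
Context (M n : nat) (X : 'I_M * 'I_n * bool -> {RV P >-> R}) (s : R).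
Hypotheses (s0 : 0 < s) (indepX : mutually_independent X)
  (lawX : forall t, normal_law (X t) 0 s).

Let X' (k : 'I_M * bool) (j : 'I_n) : T -> R := X (k.1, j, k.2).

Lemma all_cols_prob (js : seq 'I_n) (B : 'I_n -> 'I_M * bool -> set R) :
  uniq js -> (forall j k, measurable (B j k)) ->
  P (all_cols X' js B) = (\prod_(j <- js) \prod_k normal_prob 0 s (B j k))%E.
Proof.
move=> ujs mB.
(* Entries outside the columns of [js] are left unconstrained and contribute factors 1. *)
pose B' (t : 'I_M * 'I_n * bool) :=
  if t.1.2 \in js then B t.1.2 (t.1.1, t.2) else setT.
have mB' t : measurable (B' t) by rewrite /B'; case: ifP.
rewrite (_ : all_cols _ _ _ = \bigcap_t (X t @^-1` B' t)); last first.
  apply/seteqP; split => w /=.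
    move=> h [[k j] b] _ /=; rewrite /B'/=; case: ifP => // jjs.
    exact: (h j jjs (k, b)).
  move=> h j jjs [k b]; have := h (k, j, b) Logic.I.
  by rewrite /B'/= jjs.
rewrite indepX//.
pose h (p : 'I_n * ('I_M * bool)) := (p.2.1, p.1, p.2.2).
rewrite (reindex h)/=; last first.
  exists (fun t => (t.1.2, (t.1.1, t.2))).
    by move=> [j [k b]].
  by move=> [[k j] b].
rewrite -(pair_bigA _ (fun j k => P (X (h (j, k)) @^-1` B' (h (j, k)))))/=.
rewrite [RHS](big_uniq _ ujs) [RHS]big_mkcond/=; apply: eq_bigr => j _.
case: ifP => jjs.
  apply: eq_bigr => -[k b] _; rewrite lawX// /B'/= jjs.
  by [].
apply: big1 => -[k b] _; rewrite /B'/= jjs preimage_setT.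
exact: probability_setT.
Qed.

(** After division by some [y k0 != 0], each column sum has deviation [S] with
    [|y k0| S = s ||y||_2 >= s b]. [normal_prob_ball] bounds each factor, and independence
    multiplies them. *)
Lemma column_small_ball (js : seq 'I_n) (y : 'I_M * bool -> R) (r b : R) :
  uniq js -> 0 <= r -> 0 < b -> b ^+ 2 <= \sum_k y k ^+ 2 ->
  (P [set w | forall j, j \in js -> (`|\sum_k y k * X (k.1, j, k.2) w| <= r)%R]
    <= ((r / (s * b)) ^+ size js)%:E)%E.
Proof.
move=> ujs r0 b0 yb.
have [k0 yk0] : exists k0, y k0 != 0.
  apply/existsP; rewrite -[X in is_true X]negbK negb_exists; apply/negP => /forallP y0.
  move: yb; rewrite big1 ?real_leNgt ?num_real ?exprn_gt0//.
  by move=> k _; move: (y0 k); rewrite negbK => /eqP ->; rewrite expr0n.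
pose z k := y k / y k0.
pose rho := r / `|y k0|.
have rho0 : 0 <= rho by rewrite divr_ge0.
set S := Num.sqrt (s ^+ 2 + \sum_(k | k != k0) z k ^+ 2 * s ^+ 2).
have S0 : 0 < S.
  rewrite sqrtr_gt0 ltr_pwDl ?exprn_gt0// sumr_ge0// => k _.
  by rewrite mulr_ge0 ?sqr_ge0.
have SE : `|y k0| * S = s * Num.sqrt (\sum_k y k ^+ 2).
  rewrite -sqrtr_sqr -sqrtrM ?sqr_ge0// -[in RHS](gtr0_norm s0) -sqrtr_sqr.
  rewrite -sqrtrM ?sqr_ge0//; congr Num.sqrt.
  rewrite mulrDr mulr_sumr [in RHS](bigD1 k0)//= [in RHS]mulrDr [in RHS]mulr_sumr.
  rewrite mulrC; congr (_ + _); apply: eq_bigr => k _; rewrite /z.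
  by field.
have rhoS : rho / S <= r / (s * b).
  rewrite /rho -mulrA -invfM SE ler_wpM2l// lef_pV2 ?posrE ?mulr_gt0//.
    rewrite ler_pM2l// -(gtr0_norm b0) -sqrtr_sqr ler_wsqrtr//.
  by rewrite sqrtr_gt0 (lt_le_trans _ yb)// exprn_gt0.
pose D (j : 'I_n) : set R := `[- rho, rho]%classic.
have mX' k j : measurable_fun setT (X' k j) by exact: measurable_funPT.
have mD j : measurable (D j) by exact: measurable_itv.
rewrite (_ : [set _ | _] = all_in js (fun j w => X' k0 j w +
    \sum_(k | k != k0) z k * X' k j w) D); last first.
  have E j w : \sum_k y k * X (k.1, j, k.2) w =
      y k0 * (X' k0 j w + \sum_(k | k != k0) z k * X' k j w).
    rewrite (bigD1 k0)//= mulrDr mulr_sumr; congr (_ + _).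
    by apply: eq_bigr => k _; rewrite /z mulrA (mulrC (y k0)) divfK.
  apply/seteqP; split => w /= h j jjs; have := h j jjs.
    by rewrite E normrM mulrC -ler_pdivlMr ?normr_gt0// ler_norml /D/= in_itv/=.
  by rewrite E normrM mulrC -ler_pdivlMr ?normr_gt0// ler_norml /D/= in_itv/=.
rewrite -[X in P X]setIT (normal_columns_law k0 z s0 mX')//; last first.
  by move=> B mB; rewrite setIT all_cols_prob// probability_setT mule1.
rewrite probability_setT mule1 -/S.
have r1 : 0 <= r / (s * b) by rewrite divr_ge0 ?mulr_ge0// ltW.
elim: (js) => [|j l IH]; first by rewrite big_nil expr0.
rewrite big_cons /= exprS EFinM; apply: lee_pmul => //.
  by apply: (big_ind (fun x : \bar R => 0 <= x)%E) => // x y' *; rewrite mule_ge0.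
by rewrite (le_trans (normal_prob_ball _ _))// lee_fin.
Qed.

End ColumnSmallBall.

(** * Pruning, noise and edge weights *)

Section ComplexModulus.
Context {R : realType}.
Implicit Types u v z : R[i].

Lemma cabs_ge0 z : 0 <= cabs z.
Proof. by case: z => a b; exact: sqrtr_ge0. Qed.

Lemma sqr_cabs z : cabs z ^+ 2 = complex.Re z ^+ 2 + complex.Im z ^+ 2.
Proof. by case: z => a b; rewrite sqr_sqrtr// addr_ge0 ?sqr_ge0. Qed.

Lemma cabsM u v : cabs (u * v) = cabs u * cabs v.
Proof. exact: ComplexField.Normc.normcM. Qed.

Lemma cabs_conj z : cabs (conjc z) = cabs z.
Proof. by case: z => a b; rewrite /cabs/= sqrrN. Qed.

Lemma normrCE z : `|z| = (cabs z)%:C%C.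
Proof. by case: z. Qed.

Lemma cabs_le_add u v : cabs u <= cabs (u + v) + cabs v.
Proof. by rewrite -lecR rmorphD /= -!normrCE -[X in `|X| <= _](addrK v) ler_normB. Qed.

End ComplexModulus.

Section Pruning.
Context {R : realType} (n : nat) (e : rel 'I_n) (f : 'I_n -> 'I_n -> R).

(* Each pruned edge is at most as heavy as a surviving one, hence it removes a
   vertex of [Bad] or an edge of [Big]. *)
Lemma prune_run_count (r : R) (Bad : {set 'I_n}) (Big : {set 'I_n * 'I_n})
    k H (i j : 'I_n) :
  (forall a b : 'I_n, (a < b)%N -> e a b -> f a b < r ->
    [\/ a \in Bad, b \in Bad | (a, b) \in Big]) ->
  prune_run e f k H -> (i < j)%N -> e i j -> i \in H -> j \in H -> f i j < r ->
  (k <= #|Bad :\: H| + #|[set p in Big | p.1 \notin H]%SET|)%N.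
Proof.
move=> hyp run ij eij iH jH fij; elim: run iH jH => [//|k' H0 H1 _ IH].
(* A stalled step would mean that no edge is left, but [{i, j}] survives. *)
case; last first.
  by move=> [noedge ->] iH jH; case: (noedge i j ij eij).
move=> [a [b [/andP[ab eab] aH bH amin ->]]] iH jH.
have iH0 : i \in H0 by move: iH; rewrite !inE => /and3P[].
have jH0 : j \in H0 by move: jH; rewrite !inE => /and3P[].
have fab : f a b < r by exact: le_lt_trans (amin i j ij eij iH0 jH0) fij.
set H' := (H0 :\ a) :\ b.
have HH' : H' \subset H0 by apply/fintype.subsetP => x; rewrite !inE => /and3P[].
have s1 : (Bad :\: H0 \subset Bad :\: H')%SET by exact: finset.setDS.
have s2 : [set p in Big | p.1 \notin H0]%SET \subset [set p in Big | p.1 \notin H']%SET.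
  apply/fintype.subsetP => p; rewrite !inE => /andP[-> /=]; apply: contra.
  by move=> /and3P[].
apply: (leq_ltn_trans (IH iH0 jH0)).
have aH' : a \notin H' by rewrite !inE eqxx/= andbF.
have bH' : b \notin H' by rewrite !inE eqxx.
(* Since [a] and [b] leave the vertex set in this step, one of the two counted sets gains an
   element. *)
case: (hyp a b ab eab fab) => [aB|bB|abB].
- rewrite -addSn leq_add ?subset_leq_card//; apply: proper_card.
  by apply/properP; split => //; exists a; rewrite finset.in_setD ?aH' ?aH.
- rewrite -addSn leq_add ?subset_leq_card//; apply: proper_card.
  by apply/properP; split => //; exists b; rewrite finset.in_setD ?bH' ?bH.
- rewrite -addnS leq_add ?subset_leq_card//; apply: proper_card.
  by apply/properP; split => //; exists (a, b); rewrite finset.inE ?abB ?aH ?aH'.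
Qed.

End Pruning.

Section Noise.
Context {R : realType} (M n : nat) (e : rel 'I_n).
Implicit Types (eps : 'I_n -> 'I_n -> R[i]) (b : R).

Definition noisy_edges eps b : {set 'I_n * 'I_n} :=
  [set p : 'I_n * 'I_n | [&& (p.1 < p.2)%N, e p.1 p.2 & b < cabs (eps p.1 p.2)]]%SET.

(** Each noisy edge contributes more than [(b / M) ^+ 2] to the squared norm, which is below
    [b ^+ 2 / M], that is [M] times this amount. *)
Lemma card_noisy_edges eps b : (0 < M)%N -> 0 < b ->
  noise_norm e eps < b / Num.sqrt M%:R -> (#|noisy_edges eps (b / M%:R)| <= M)%N.
Proof.
move=> M0 b0 noise.
have M0' : 0 < M%:R :> R by rewrite ltr0n.
have sM : 0 < Num.sqrt (M%:R : R) by rewrite sqrtr_gt0.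
set s := \sum_(i < n) \sum_(j < n | (i < j)%N && e i j) cabs (eps i j) ^+ 2.
have s0 : 0 <= s by apply: sumr_ge0 => i _; apply: sumr_ge0 => j _; exact: sqr_ge0.
have sb : s < b ^+ 2 / M%:R.
  rewrite -[ltLHS](sqr_sqrtr s0) -[M%:R in ltRHS]sqr_sqrtr ?ltW// -expr_div_n.
  by rewrite ltr_pXn2r// nnegrE ?sqrtr_ge0// divr_ge0// ltW.
have le_s : #|noisy_edges eps (b / M%:R)|%:R * (b / M%:R) ^+ 2 <= s.
  rewrite /s pair_big_dep/= mulr_natl -sumr_const.
  rewrite [leLHS]big_mkcond [leRHS]big_mkcond/=; apply: ler_sum => -[i j] _.
  rewrite inE/=; case: ifP => [/and3P[-> -> h]/=|_].
    by rewrite ltW// ltr_pXn2r// nnegrE ?cabs_ge0// divr_ge0// ltW.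
  by case: ifP => // _; exact: sqr_ge0.
have b2 : 0 < (b / M%:R) ^+ 2 by rewrite exprn_gt0// divr_gt0.
have := le_lt_trans le_s sb.
have -> : b ^+ 2 / M%:R = M%:R * (b / M%:R) ^+ 2 by field; rewrite gt_eqF.
by rewrite ltr_pM2r// ltr_nat => /ltnW.
Qed.

End Noise.

Section Weights.
Context {R : realType} (M n : nat).
Implicit Types (Phi : 'I_M -> 'I_n -> R[i]) (x : 'I_M -> R[i]).
Implicit Types eps : 'I_n -> 'I_n -> R[i].

(** By the triangle inequality the product of the two moduli is below [2 b], so both squares cannot
    exceed [2 b]. *)
Lemma light_edge Phi x eps (i j : 'I_n) (b : R) : 0 <= b ->
  pun_weight Phi x eps i j < b -> cabs (eps i j) <= b ->
  cabs (cinner x (Phi ^~ i)) ^+ 2 <= 2 * b \/ cabs (cinner x (Phi ^~ j)) ^+ 2 <= 2 * b.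
Proof.
move=> b0 wb epsb; set ai := cinner _ _; set aj := cinner _ _.
have prod_lt : cabs ai * cabs aj < 2 * b.
  rewrite -(cabs_conj ai) -cabsM (le_lt_trans (cabs_le_add _ (eps i j)))//.
  by rewrite mulr_natl mulr2n ltr_leD.
case: (leP (cabs ai ^+ 2) (2 * b)) => hi; first by left.
case: (leP (cabs aj ^+ 2) (2 * b)) => hj; first by right.
have b20 : 0 <= 2 * b by rewrite mulr_ge0.
have : (2 * b) ^+ 2 < (cabs ai * cabs aj) ^+ 2.
  by rewrite [ltLHS]expr2 [ltRHS]exprMn ltr_pM.
rewrite ltr_pXn2r// ?nnegrE ?mulr_ge0 ?cabs_ge0//.
by move=> /(lt_trans prod_lt); rewrite ltxx.
Qed.

(** Treats [x] as a real vector with [2 M] coordinates, indexed like the real Gaussian variables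
    behind [cmatrix_of]; [column_small_ball] is stated for such sums. *)
Lemma Re_cinner x (y : 'I_M -> R[i]) :
  complex.Re (cinner x y) = \sum_(k : 'I_M * bool)
    (if k.2 then complex.Im (x k.1) * complex.Im (y k.1)
     else complex.Re (x k.1) * complex.Re (y k.1)).
Proof.
rewrite /cinner raddf_sum/=.
rewrite -(pair_bigA _ (fun k b => if b then complex.Im (x k) * complex.Im (y k)
  else complex.Re (x k) * complex.Re (y k)))/=.
apply: eq_bigr => k _; rewrite big_bool/=.
case: (x k) => a b; case: (y k) => c d /=.
by rewrite mulrN opprK addrC.
Qed.

Lemma sum_sqr_cnorm1 x : cnorm x = 1 ->
  \sum_(k : 'I_M * bool) (if k.2 then complex.Im (x k.1) else complex.Re (x k.1)) ^+ 2 = 1.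
Proof.
move=> x1.
have s0 : 0 <= \sum_(k < M) cabs (x k) ^+ 2 by apply: sumr_ge0 => k _; exact: sqr_ge0.
have <- : \sum_(k < M) cabs (x k) ^+ 2 = 1.
  by rewrite -(sqr_sqrtr s0) -[Num.sqrt _]/(cnorm x) x1 expr1n.
rewrite -(pair_bigA _ (fun k b => (if b then complex.Im (x k) else complex.Re (x k)) ^+ 2))/=.
by apply: eq_bigr => k _; rewrite big_bool/= sqr_cabs addrC.
Qed.

End Weights.

(** * A finite grid in the interval from -1 to 1 *)

Section Grid.
Context {R : realType} (L : nat).

Definition grid_point (a : 'I_(2 * L).+1) : R := a%:R / L%:R - 1.

Lemma grid_approx (y : R) : (0 < L)%N -> `|y| <= 1 ->
  exists a : 'I_(2 * L).+1, `|grid_point a - y| <= L%:R^-1.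
Proof.
move=> L0; rewrite ler_norml => /andP[ym yM].
have L0' : 0 < L%:R :> R by rewrite ltr0n.
have y0 : 0 <= (y + 1) * L%:R by rewrite mulr_ge0 ?(ltW L0')//; lra.
pose m := Num.truncn ((y + 1) * L%:R).
have /andP[m1 m2] := truncn_itv y0.
have mL : (m < (2 * L).+1)%N.
  rewrite ltnS -(ler_nat R) (le_trans m1)// natrM ler_wpM2r ?(ltW L0')//; lra.
exists (Ordinal mL); rewrite /grid_point/= -/m.
have -> : m%:R / L%:R - 1 - y = (m%:R - (y + 1) * L%:R) / L%:R :> R.
  by field; rewrite gt_eqF.
rewrite normrM normfV (gtr0_norm L0') ler_pdivrMr// mulVf ?gt_eqF//.
rewrite ler_norml; move: m1 m2; rewrite -/m -natr1 => m1 m2; apply/andP; split; lra.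
Qed.

End Grid.

(** * The exceptional event in a fixed dimension *)

Section FixedDimension.
Context {R : realType} d (T : measurableType d) (P : probability T R).
Context (M n : nat) (X : 'I_M * 'I_n * bool -> {RV P >-> R}) (c : R).
Hypotheses (M0 : (0 < M)%N) (iidX : complex_gaussian_iid X).
Hypotheses (c0 : 0 < c) (Mc : (4 * M%:R)^-1 <= c / Num.sqrt M%:R).

(** If entries are at most 1, an error [1 / L] in each of the [2 M] coordinates changes a column sum
    by at most [2 M / L = 1 / (4 M)], which [Mc] bounds by [c / sqrtM]. *)
Let L := (8 * M ^ 2)%N.
Let grid := {ffun 'I_M * bool -> 'I_(2 * L).+1}.
Let gp (g : grid) (k : 'I_M * bool) : R := grid_point (g k).
Let sqrtM : R := Num.sqrt M%:R.
Let col (y : 'I_M * bool -> R) (j : 'I_n) (w : T) : R :=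
  \sum_k y k * X (k.1, j, k.2) w.

Let M0' : 0 < M%:R :> R. Proof. by rewrite ltr0n. Qed.
Let sqrtM0 : 0 < sqrtM. Proof. by rewrite sqrtr_gt0. Qed.
Let sqr_sqrtM : sqrtM ^+ 2 = M%:R. Proof. by rewrite sqr_sqrtr// ltW. Qed.

Definition large_entry t : set T := [set w | (1 < `|X t w|)%R].
(** The factor 2 leaves room for the grid error on top of the bound [c / sqrtM] for the true
    vector. *)
Definition small_columns (p : grid * {set 'I_n}) : set T :=
  [set w | forall j, j \in enum p.2 -> (`|col (gp p.1) j w| <= 2 * c / sqrtM)%R].
(** Grid points of norm below 1/2 are discarded: small-ball estimates degenerate near 0, and no unit
    vector needs them. *)
Definition relevant m (p : grid * {set 'I_n}) :=
  ((1 / 2) ^+ 2 <= \sum_k gp p.1 k ^+ 2) && (m <= #|p.2|)%N.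

Lemma measurable_large_entry t : measurable (large_entry t).
Proof.
rewrite (_ : large_entry t = X t @^-1` [set x : R | 1 < `|x|]%R)//.
rewrite -[X in measurable X]setTI; apply: measurable_funPT => //.
exact: measurable_norm_gt1.
Qed.

Lemma measurable_small_columns p : measurable (small_columns p).
Proof.
rewrite (_ : small_columns p = all_in (enum p.2) (col (gp p.1))
    (fun=> `[- (2 * c / sqrtM), 2 * c / sqrtM]%classic)).
  apply: measurable_all_in => // j; apply: measurable_sum => k.
  exact: measurable_funM.
by apply/seteqP; split => w h j jp; have := h j jp; rewrite /= in_itv/= ler_norml.
Qed.

(** The variance is [1 / (2 M)], which turns the exponent [3 / (8 s ^+ 2)] of the tail bound into
    [3 M / 4]. *)
Lemma large_entry_prob t :
  (P (large_entry t) <= (2 * expR (- (3 / 4 * M%:R)))%:E)%E.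
Proof.
case: iidX => _ /(_ t) law.
have s0 : 0 < Num.sqrt (1 / (2 * M%:R)) :> R by rewrite sqrtr_gt0 divr_gt0 ?mulr_gt0.
have mt := @measurable_norm_gt1 R.
rewrite [P _](law _ mt) (le_trans (normal_prob_tail s0))// lee_fin ler_wpM2l//.
rewrite ler_expR lerN2 sqr_sqrtr; last by rewrite divr_ge0// mulr_ge0// ltW.
by rewrite le_eqVlt; apply/orP; left; apply/eqP; field; rewrite gt_eqF.
Qed.

(** The small-ball ratio has radius [2 c / sqrtM], norm at least 1/2 and deviation at least
    [1 / (2 sqrtM)], hence is at most [8 c]. As [8 c <= 1], the exponent may be lowered from the
    number of columns to [m]. *)
Lemma small_columns_prob m p : 8 * c <= 1 -> relevant m p ->
  (P (small_columns p) <= ((8 * c) ^+ m)%:E)%E.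
Proof.
move=> c1 /andP[norm_p mp].
have s0 : 0 < Num.sqrt (1 / (2 * M%:R)) :> R by rewrite sqrtr_gt0 divr_gt0 ?mulr_gt0.
have r0 : 0 <= 2 * c / sqrtM by rewrite divr_ge0 ?mulr_ge0// ltW.
have := column_small_ball s0 iidX.1 iidX.2 (enum_uniq p.2) r0 (b := 1 / 2) _ norm_p.
move=> /(_ _)/le_trans; apply; first by rewrite divr_gt0.
rewrite lee_fin -cardE.
have sM : (2 * sqrtM)^-1 <= Num.sqrt (1 / (2 * M%:R)).
  rewrite -[leLHS]ger0_norm ?invr_ge0 ?mulr_ge0 ?(ltW sqrtM0)// -sqrtr_sqr.
  rewrite ler_wsqrtr// exprVn exprMn sqr_sqrtM div1r lef_pV2 ?posrE ?mulr_gt0//.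
  by rewrite ler_wpM2r ?(ltW M0')//; lra.
have q_le : 2 * c / sqrtM / (Num.sqrt (1 / (2 * M%:R)) * (1 / 2)) <= 8 * c.
  rewrite ler_pdivrMr ?mulr_gt0//.
  apply: (@le_trans _ _ (8 * c * ((2 * sqrtM)^-1 * (1 / 2)))).
    by rewrite le_eqVlt; apply/orP; left; apply/eqP; field; rewrite gt_eqF.
  by rewrite ler_wpM2l ?mulr_ge0 ?(ltW c0)// ler_wpM2r.
have q0 : 0 <= 2 * c / sqrtM / (Num.sqrt (1 / (2 * M%:R)) * (1 / 2)).
  by rewrite divr_ge0// mulr_ge0.
apply: (@le_trans _ _ ((8 * c) ^+ #|p.2|)).
  by rewrite lerXn2r// nnegrE mulr_ge0// ltW.
by apply: ler_wiXn2l => //; rewrite mulr_ge0// ltW.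
Qed.

(** Only finitely many events are excluded, so measurability is immediate although the conclusion
    quantifies over all unit [x] and all noise vectors. *)
Definition good_event m : set T :=
  ~` (\big[setU/set0]_t large_entry t `|`
      \big[setU/set0]_(p | relevant m p) small_columns p).

Lemma measurable_good_event m : measurable (good_event m).
Proof.
apply/measurableC/measurableU; apply: bigsetU_measurable => i _.
  exact: measurable_large_entry.
exact: measurable_small_columns.
Qed.

(** Union bound over [2 M n] real entries, and over pairs of a grid point with [2 M] coordinates and
    a subset of the columns. *)
Lemma good_event_prob m : 8 * c <= 1 ->
  ((1 - (4 * M%:R * n%:R * expR (- (3 / 4 * M%:R)) +
         ((16 * M ^ 2).+1 ^ (2 * M) * 2 ^ n)%:R * (8 * c) ^+ m))%:E
    <= P (good_event m))%E.
Proof.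
move=> c1.
have m1 : measurable (\big[setU/set0]_t large_entry t).
  by apply: bigsetU_measurable => i _; exact: measurable_large_entry.
have m2 : measurable (\big[setU/set0]_(p | relevant m p) small_columns p).
  by apply: bigsetU_measurable => i _; exact: measurable_small_columns.
rewrite /good_event probability_setC; last exact: measurableU.
rewrite EFinD EFinN leeD2l// leeN2 (le_trans (measureU2 P m1 m2))// EFinD.
have k1 : 0 <= 2 * expR (- (3 / 4 * M%:R)) :> R by rewrite mulr_ge0 ?expR_ge0.
have k2 : 0 <= (8 * c) ^+ m by rewrite exprn_ge0// mulr_ge0// ltW.
apply: leeD.
  have h t : xpredT t -> (P (large_entry t) <= (2 * expR (- (3 / 4 * M%:R)))%:E)%E.
    by move=> _; exact: large_entry_prob.
  apply: (le_trans (union_bound (index_enum _) k1 measurable_large_entry h)).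
  rewrite lee_fin /index_enum -enumT -cardE !card_prod !card_ord card_bool.
  rewrite !natrM le_eqVlt; apply/orP; left; apply/eqP; ring.
have h p : relevant m p -> (P (small_columns p) <= ((8 * c) ^+ m)%:E)%E.
  exact: small_columns_prob.
apply: (le_trans (union_bound (index_enum _) k2 measurable_small_columns h)).
rewrite lee_fin ler_wpM2r// /index_enum -enumT -cardE card_prod card_ffun.
rewrite card_prod !card_ord card_bool -cardsT -powersetT card_powerset cardsT card_ord.
by rewrite ler_nat /L mulnA (mulnC M).
Qed.

Lemma good_event_entry m w t : good_event m w -> `|X t w| <= 1.
Proof.
move=> gw; rewrite leNgt; apply/negP => Xw; apply: gw; left.
by rewrite (bigD1 t)//=; left.
Qed.

Lemma good_event_columns m w p : good_event m w -> relevant m p ->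
  ~ small_columns p w.
Proof.
move=> gw Qp pw; apply: gw; right.
by rewrite (bigD1 p)//=; left.
Qed.

Lemma unit_grid_approx (y : 'I_M * bool -> R) : \sum_k y k ^+ 2 = 1 ->
  exists g : grid, (forall k, `|gp g k - y k| <= L%:R^-1) /\
    (1 / 2) ^+ 2 <= \sum_k gp g k ^+ 2.
Proof.
move=> y1.
have L0 : (0 < L)%N by rewrite muln_gt0 expn_gt0 M0.
have LR : 0 < L%:R :> R by rewrite ltr0n.
have y_le1 k : `|y k| <= 1.
  rewrite -(@ler_pXn2r _ 2)// ?nnegrE// expr1n real_normK ?num_real// -y1.
  by rewrite (bigD1 k)//= lerDl sumr_ge0// => i _; exact: sqr_ge0.
have /choice[g gP] : forall k, exists a : 'I_(2 * L).+1,
    `|grid_point a - y k| <= L%:R^-1.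
  by move=> k; exact: grid_approx.
exists [ffun k => g k]; split; first by move=> k; rewrite /gp ffunE.
(* From [a ^+ 2 >= y ^+ 2 + 2 (a - y) y], each coordinate loses at most [2 / L]. The total loss is
   [1 / (2 M) <= 1/2], leaving at least 1/2. *)
apply: (@le_trans _ _ (\sum_k (y k ^+ 2 - 2 * L%:R^-1))).
  rewrite sumrB y1 sumr_const card_prod card_ord card_bool -[X in _ - X]mulr_natl.
  have -> : (M * 2)%:R * (2 * L%:R^-1) = (2 * M%:R)^-1 :> R.
    by rewrite /L !natrM; field; rewrite gt_eqF.
  have : (2 * M%:R)^-1 <= 2^-1 :> R.
    by rewrite lef_pV2 ?posrE ?mulr_gt0// ler_peMr// ler1n.
  lra.
apply: ler_sum => k _; rewrite /gp ffunE.
set a := grid_point (g k).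
have : `|(a - y k) * y k| <= L%:R^-1.
  by rewrite normrM -[leRHS]mulr1 ler_pM// gP.
rewrite ler_norml => /andP[h _].
have := sqr_ge0 (a - y k).
nra.
Qed.
(** If [m] columns were small for [x], this set of columns and a grid point near [x] would form an
    excluded pair. *)
Lemma good_event_inner m w (x : 'I_M -> R[i]) : good_event m w -> cnorm x = 1 ->
  (#|[set j | (cabs (cinner x (cmatrix_of X w ^~ j)) ^+ 2 <= c ^+ 2 / M%:R)%R]%SET| < m)%N.
Proof.
move=> gw x1; set Bad := [set j | _]%SET; rewrite ltnNge; apply/negP => mBad.
pose y (k : 'I_M * bool) := if k.2 then complex.Im (x k.1) else complex.Re (x k.1).
have [g [gy g1]] := unit_grid_approx (sum_sqr_cnorm1 x1 : \sum_k y k ^+ 2 = 1).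
apply: (@good_event_columns m w (g, Bad) gw); first by rewrite /relevant g1.
move=> j; rewrite mem_enum inE => small_j.
have yE : complex.Re (cinner x (cmatrix_of X w ^~ j)) = col y j w.
  by rewrite Re_cinner; apply: eq_bigr => -[k []].
have col_y : `|col y j w| <= c / sqrtM.
  have cM0 : 0 <= c / sqrtM by rewrite divr_ge0 ?ltW.
  rewrite -(@ler_pXn2r _ 2)// ?nnegrE// real_normK ?num_real// -yE.
  by rewrite expr_div_n sqr_sqrtM (le_trans _ small_j)// sqr_cabs lerDl sqr_ge0.
have col_diff : `|col (gp g) j w - col y j w| <= (4 * M%:R)^-1.
  rewrite /col -sumrB; apply: (le_trans (ler_norm_sum _ _ _)).
  apply: (@le_trans _ _ (\sum_(k : 'I_M * bool) L%:R^-1)).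
    apply: ler_sum => k _; rewrite -mulrBl normrM -[leRHS]mulr1.
    by rewrite ler_pM// (good_event_entry _ gw).
  rewrite sumr_const card_prod card_ord card_bool -[leLHS]mulr_natl.
  rewrite le_eqVlt; apply/orP; left; apply/eqP.
  by rewrite /L !natrM; field; rewrite gt_eqF.
have -> : col (gp g) j w = col (gp g) j w - col y j w + col y j w by rewrite subrK.
rewrite (le_trans (ler_normD _ _))//; move: Mc; rewrite -/sqrtM => Mc'.
have -> : 2 * c / sqrtM = c / sqrtM + c / sqrtM by rewrite -mulrDl; congr (_ / _); ring.
by rewrite lerD// (le_trans col_diff).
Qed.

(** The deterministic half: on the good event, pruning is analysed for an arbitrary noise vector,
    with no further probability. *)
Lemma good_event_PUN (e : rel 'I_n) (alpha : R) m w (eps : 'I_n -> 'I_n -> R[i]) :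
  good_event m w -> (m + M <= Num.truncn ((1 - alpha) * n%:R))%N ->
  ((c ^+ 2 / 2 / sqrtM)%:E <= maxe (noise_norm e eps)%:E
    (sqrtM%:E * PUN e (cmatrix_of X w) alpha eps))%E.
Proof.
move=> gw mk; set b := c ^+ 2 / 2.
have b0 : 0 < b by rewrite divr_gt0// exprn_gt0.
have bM0 : 0 < b / M%:R by rewrite divr_gt0.
rewrite le_max; apply/orP.
(* Large noise settles the claim by the first term of the maximum; otherwise few edges are noisy. *)
have [noise|noise] := leP (b / sqrtM) (noise_norm e eps).
  by left; rewrite lee_fin.
right.
have -> : b / sqrtM = sqrtM * (b / M%:R).
  by rewrite -sqr_sqrtM; field; rewrite gt_eqF.
rewrite EFinM lee_wpmul2l ?lee_fin ?(ltW sqrtM0)//.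
apply: le_ereal_inf_tmp => _ [x [i [j [J [x1 /andP[ij eij] run /andP[iJ jJ] ->]]]]].
rewrite lee_fin leNgt; apply/negP => wij.
set Bad := [set j | (cabs (cinner x (cmatrix_of X w ^~ j)) ^+ 2 <= c ^+ 2 / M%:R)%R]%SET.
have light (k l : 'I_n) : (k < l)%N -> e k l ->
    pun_weight (cmatrix_of X w) x eps k l < b / M%:R ->
    [\/ k \in Bad, l \in Bad | (k, l) \in noisy_edges e eps (b / M%:R)].
  move=> kl ekl wkl.
  have [small_eps|big_eps] := leP (cabs (eps k l)) (b / M%:R).
    have c2E : 2 * (b / M%:R) = c ^+ 2 / M%:R by rewrite /b; field; rewrite gt_eqF.
    have [] := light_edge (ltW bM0) wkl small_eps; rewrite c2E => small.
      by apply: Or31; rewrite inE.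
    by apply: Or32; rewrite inE.
  by apply: Or33; rewrite inE/= kl ekl.
(* Fewer than [m] small columns and at most [M] noisy edges cannot account for [m + M] pruning
   steps. *)
have : (Num.truncn ((1 - alpha) * n%:R) <= #|Bad| + M)%N.
  apply: (leq_trans (prune_run_count light run ij eij iJ jJ wij)).
  apply: leq_add; first by apply: subset_leq_card; exact: finset.subsetDl.
  apply: leq_trans (card_noisy_edges M0 b0 noise).
  by apply: subset_leq_card; apply/fintype.subsetP => p; rewrite !inE => /andP[].
move=> /(leq_trans mk); rewrite leq_add2r leqNgt.
by rewrite (good_event_inner gw x1).
Qed.

End FixedDimension.

(** * Asymptotics *)

Section Asymptotics.
Context {R : realType}.

(** Cubic term of the exponential series at [x / 4], with [384 = 4 ^ 3 * 3!]. *)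
Lemma cube_le_expR (x : R) : 0 <= x -> x ^+ 3 <= 384 * expR (x / 4).
Proof.
move=> x0; have x40 : 0 <= x / 4 by rewrite divr_ge0.
have := expR_ge1Dxn 2 x40; rewrite (_ : (3`!)%N = 6%N)// => h.
have -> : x ^+ 3 = 384 * ((x / 4) ^+ 3 / 6) by field.
rewrite ler_wpM2l//; lra.
Qed.

Context (C kappa : R) (M n k : nat).
Hypotheses (C0 : 0 < C) (kappa0 : 0 < kappa) (M17 : (17 <= M)%N).
Let l := ln (M%:R : R).
Hypotheses (l1 : 1 <= l) (kl : 2 <= kappa * l).
Hypothesis (n_ub : n%:R <= 2 * C * (M%:R * l)).
Hypothesis (k_lb : 2 * kappa * (M%:R * l) - 1 <= k%:R).

Let M1 : 1 <= M%:R :> R. Proof. by rewrite ler1n (leq_trans _ M17). Qed.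
Let M0 : 0 < M%:R :> R. Proof. exact: lt_le_trans M1. Qed.
Let expl : expR l = M%:R. Proof. by rewrite lnK// posrE. Qed.

(** [kl] gives [M + 1 <= 2 M <= kappa M l], so removing [M] and the rounding loss 1 costs at most
    half of [2 kappa M l]. *)
Lemma pruned_lb : kappa * (M%:R * l) <= (k - M)%:R :> R /\ (M <= k)%N.
Proof.
have h : 2 * M%:R <= kappa * (M%:R * l).
  by rewrite mulrCA mulrC ler_wpM2l// ltW.
have k_lb' : 2 * (kappa * (M%:R * l)) - 1 <= k%:R by rewrite mulrA.
have M1' := M1; move: h k_lb'; set p := kappa * _ => h k_lb'.
have Mk : (M <= k)%N by rewrite -(ler_nat R); lra.
by split => //; rewrite natrB//; lra.
Qed.

(** Since [l <= M], the prefactor is at most [8 C M ^ 3], which a factor [exp (M / 4)] taken from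
    the decay absorbs. *)
Lemma entry_failure_ub :
  4 * M%:R * n%:R * expR (- (3 / 4 * M%:R)) <= 3072 * C * expR (- (1 / 2) * M%:R) :> R.
Proof.
have lM : l <= M%:R by have := expR_ge1Dx l; rewrite expl; lra.
have e1 : expR (- (1 / 2) * M%:R) = expR (M%:R / 4) * expR (- (3 / 4 * M%:R)) :> R.
  by rewrite -expRD; congr expR; field.
rewrite e1 mulrA ler_wpM2r ?expR_ge0//.
have Ml : M%:R * l <= M%:R ^+ 2 by rewrite expr2 ler_wpM2l// ltW.
apply: (@le_trans _ _ (8 * C * M%:R ^+ 3)).
  have -> : 8 * C * M%:R ^+ 3 = 4 * M%:R * (2 * C * M%:R ^+ 2) :> R by ring.
  rewrite ler_wpM2l ?mulr_ge0 ?(ltW M0)// (le_trans n_ub)// ler_wpM2l//.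
  by rewrite mulr_ge0// ltW.
have -> : 3072 * C * expR (M%:R / 4) = 8 * C * (384 * expR (M%:R / 4)) :> R by ring.
by rewrite ler_wpM2l ?mulr_ge0 ?(ltW C0)// cube_le_expR// ltW.
Qed.

(** In units of [M l], the exponents are at most 6 for the grid, [2 C] for the subsets and
    [- (2 C + 7)] for the small columns; their sum is -1. *)
Lemma column_failure_ub (q : R) : q = expR (- ((2 * C + 7) / kappa)) ->
  ((16 * M ^ 2).+1 ^ (2 * M) * 2 ^ n)%:R * q ^+ (k - M) <= expR (- (1 / 2) * M%:R).
Proof.
move=> ->; rewrite -expRM_natl.
have [m_lb _] := pruned_lb.
(* [16 M ^ 2 + 1 <= 17 M ^ 2 <= M ^ 3] because [M >= 17]. *)
have grid_ub : ((16 * M ^ 2).+1 ^ (2 * M))%:R <= expR (6 * (M%:R * l)) :> R.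
  have -> : 6 * (M%:R * l) = (2 * M)%:R * (3%:R * l) :> R by rewrite natrM; ring.
  rewrite expRM_natl expRM_natl expl natrX lerXn2r// ?nnegrE//.
  rewrite -natrX ler_nat.
  apply: (@leq_trans (17 * M ^ 2)%N); last by rewrite (expnS M 2) leq_mul2r M17 orbT.
  by rewrite (mulSn 16) -add1n leq_add2r expn_gt0 (leq_trans _ M17).
have pow2_ub : (2 ^ n)%:R <= expR (2 * C * (M%:R * l)) :> R.
  apply: (@le_trans _ _ (expR (n%:R * 1))); last by rewrite mulr1 ler_expR.
  rewrite expRM_natl natrX lerXn2r// ?nnegrE ?expR_ge0//.
  by have := expR_ge1Dx (1 : R); lra.
have col_ub : expR ((k - M)%:R * - ((2 * C + 7) / kappa)) <=
    expR (- (2 * C + 7) * (M%:R * l)).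
  rewrite ler_expR mulrN mulNr lerN2.
  have -> : (2 * C + 7) * (M%:R * l) = kappa * (M%:R * l) * ((2 * C + 7) / kappa).
    by field; rewrite gt_eqF.
  by rewrite ler_wpM2r// divr_ge0 ?(ltW kappa0)// addr_ge0// mulr_ge0// ltW.
rewrite natrM; apply: (@le_trans _ _ (expR (6 * (M%:R * l)) * expR (2 * C * (M%:R * l)) *
    expR (- (2 * C + 7) * (M%:R * l)))).
  by rewrite ler_pM ?mulr_ge0 ?expR_ge0// ler_pM.
rewrite -!expRD ler_expR.
have Ml : M%:R <= M%:R * l by rewrite ler_peMr// ltW.
rewrite (_ : _ + _ = - (M%:R * l)); last by ring.
by have := M1; lra.
Qed.

End Asymptotics.

(** * Choice of constants and conclusion *)

Theorem theorem6p8 (R : realType) (C : R) (n : nat -> nat)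
    (e : forall M : nat, rel 'I_(n M)) :
  0 < C ->
  (forall M : nat, simple_graph (e M)) ->
  (fun M : nat => (n M)%:R / (C * M%:R * ln (M%:R : R))) @ \oo --> (1 : R) ->
  forall alpha : R, 0 < alpha -> alpha < 1 - 1 / (2 * C) ->
  exists C' : R, 0 < C' /\
  exists c0 c1 : R, [/\ 0 < c0, 0 < c1 &
  forall M : nat, (0 < M)%N ->
  forall (d : measure_display) (T : measurableType d) (P : probability T R)
    (X : 'I_M * 'I_(n M) * bool -> {RV P >-> R}),
  complex_gaussian_iid X ->
  exists A : set T, [/\ measurable A,
    ((1 - c0 * expR (- c1 * M%:R))%:E <= P A)%E &
    A `<=` [set w | forall eps : 'I_(n M) -> 'I_(n M) -> R[i],
      ((C' / Num.sqrt (M%:R : R))%:E <=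
        maxe (noise_norm (e M) eps)%:E
             ((Num.sqrt (M%:R : R))%:E * PUN (e M) (cmatrix_of X w) alpha eps))%E]]].
Proof.
move=> C0 _ n_equiv alpha alpha0 alphaC.
have alpha1 : 0 < 1 - alpha.
  have : 0 < 1 / (2 * C) by rewrite divr_gt0// mulr_gt0.
  lra.
(* Eventually [n] is at least half of [C M ln M], so the number of pruning steps is at least
   [2 kappa M ln M - 1]. *)
pose kappa := (1 - alpha) * C / 4.
have kappa0 : 0 < kappa by rewrite divr_gt0// mulr_gt0.
(* At least [kappa M ln M] columns are small, while the grid and the subsets of
   columns cost [exp ((6 + 2 C) M ln M)]. *)
pose q := expR (- ((2 * C + 7) / kappa)).
have q0 : 0 < q by exact: expR_gt0.
have q1 : q <= 1.
  rewrite -[leRHS]expR0 ler_expR oppr_le0 divr_ge0 ?(ltW kappa0)//.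
  by rewrite addr_ge0// mulr_ge0// ltW.
pose c := q / 8.
have c_gt0 : 0 < c by rewrite divr_gt0.
have [N _ n_near] : \forall M \near \oo,
    `|1 - (n M)%:R / (C * M%:R * ln (M%:R : R))| < 1 / 2.
  by move/cvgrPdist_lt : n_equiv; apply; rewrite divr_gt0.
(* [N] controls [n]; 17 serves the grid bound; the exponentials give [ln M >= 1] and
   [kappa ln M >= 2]; the last term makes the grid error at most [c / sqrt M]. *)
pose M0 := (N + 17 + Num.truncn (expR 1 + expR (2 / kappa) + (16 * c ^+ 2)^-1)).+1.
exists (c ^+ 2 / 2); split; first by rewrite divr_gt0// exprn_gt0.
pose K := 3072 * C; have K0 : 0 < K.
  by apply: mulr_gt0; [rewrite ltr0n|exact: C0].
(* [1 + K] covers the two failure probabilities for [M >= M0]. The last summand makes the lower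
   bound nonpositive for smaller [M], where the empty event suffices. *)
exists (1 + K + expR (M0%:R / 2)), (1 / 2); split.
- by rewrite addr_gt0 ?expR_gt0// addr_gt0.
- by rewrite divr_gt0.
move=> M M_gt0 d T P X iidX.
have e0 : 0 < expR (- (1 / 2) * M%:R) :> R by exact: expR_gt0.
have [M_lt|M_ge] := ltnP M M0.
  exists set0; split => //; rewrite measure0 lee_fin subr_le0.
  apply: (@le_trans _ _ (expR (M0%:R / 2) * expR (- (1 / 2) * M%:R))); last first.
    by rewrite ler_wpM2r ?(ltW e0)// lerDr addr_ge0// ltW.
  rewrite -expRD -[leLHS]expR0 ler_expR.
  have : M%:R <= M0%:R :> R by rewrite ler_nat ltnW.
  lra.
have M17 : (17 <= M)%N.
  by apply: leq_trans M_ge; rewrite /M0 addnAC -addSn leq_addl.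
have NM : (N <= M)%N.
  by apply: leq_trans M_ge; rewrite /M0 -addnA -addnS leq_addr.
have M_big : expR 1 + expR (2 / kappa) + (16 * c ^+ 2)^-1 <= M%:R.
  apply: (le_trans (ltW (truncnS_gt _))); rewrite ler_nat (leq_trans _ M_ge)//.
  by rewrite /M0 ltnS leq_addl.
have c2_gt0 : 0 < (16 * c ^+ 2)^-1 by rewrite invr_gt0 mulr_gt0// exprn_gt0.
have Mr0 : 0 < M%:R :> R by rewrite ltr0n.
have l1 : 1 <= ln (M%:R : R).
  rewrite -[leLHS]expRK ler_ln ?posrE ?expR_gt0//.
  by have := expR_gt0 (2 / kappa); lra.
have kl : 2 <= kappa * ln (M%:R : R).
  rewrite -ler_pdivrMl// mulrC -[leLHS]expRK ler_ln ?posrE ?expR_gt0//.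
  by have := expR_gt0 (1 : R); lra.
have Ml0 : 0 < M%:R * ln (M%:R : R) by rewrite mulr_gt0// (lt_le_trans _ l1).
have := n_near M NM; rewrite /= ltr_norml => /andP[n1 n2].
have ratioE : (n M)%:R =
    (n M)%:R / (C * M%:R * ln (M%:R : R)) * (C * (M%:R * ln (M%:R : R))).
  by rewrite -(mulrA C) divfK// gt_eqF// mulr_gt0.
have n_ub : (n M)%:R <= 2 * C * (M%:R * ln (M%:R : R)).
  rewrite ratioE -[leRHS]mulrA ler_wpM2r//; last lra.
  by rewrite mulr_ge0// ltW.
have n_lb : 1 / 2 * (C * (M%:R * ln (M%:R : R))) <= (n M)%:R.
  rewrite ratioE ler_wpM2r//; last lra.
  by rewrite mulr_ge0// ltW.
set k := Num.truncn ((1 - alpha) * (n M)%:R).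
have k_lb : 2 * kappa * (M%:R * ln (M%:R : R)) - 1 <= k%:R.
  have := truncnS_gt ((1 - alpha) * (n M)%:R); rewrite -/k -natr1 => k_gt.
  have : (1 - alpha) * (1 / 2 * (C * (M%:R * ln (M%:R : R)))) <= (1 - alpha) * (n M)%:R.
    by rewrite ler_wpM2l// ltW.
  have -> : (1 - alpha) * (1 / 2 * (C * (M%:R * ln (M%:R : R)))) =
    2 * kappa * (M%:R * ln (M%:R : R)) by rewrite /kappa; field.
  lra.
have [_ Mk] := pruned_lb M17 kl k_lb.
have Mc : (4 * M%:R)^-1 <= c / Num.sqrt M%:R.
  have sM0 : 0 < Num.sqrt (M%:R : R) by rewrite sqrtr_gt0.
  move: (sqr_sqrtr (ltW Mr0)) sM0; set s := Num.sqrt _ => s2 s0.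
  (* The wanted inequality amounts to [1 <= 4 c sqrt M], whose square is [1 <= 16 c ^+ 2 M]. *)
  have cM : 1 <= (4 * c * s) ^+ 2.
    rewrite exprMn s2 mulrC -ler_pdivrMr ?exprn_gt0 ?mulr_gt0//.
    rewrite div1r exprMn (_ : 4 ^+ 2 = 16); last by ring.
    by have := expR_gt0 (1 : R); have := expR_gt0 (2 / kappa); lra.
  have {}cM : 1 <= 4 * c * s.
    by rewrite -(@ler_pXn2r _ 2)// ?nnegrE ?expr1n// !mulr_ge0// ltW.
  rewrite ler_pdivlMr// mulrC ler_pdivrMr ?mulr_gt0// -s2.
  have -> : c * (4 * s ^+ 2) = 4 * c * s * s by ring.
  by rewrite ler_peMl// ltW.
have qE : 8 * c = q by rewrite /c; field.
(* The [M] subtracted here are the pruning steps that noisy edges may account for. *)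
exists (good_event X c (k - M)); split.
- exact: measurable_good_event.
- apply: le_trans (good_event_prob M_gt0 iidX c_gt0 (k - M) _); last by rewrite qE.
  rewrite lee_fin qE lerD2l lerN2.
  have := entry_failure_ub C0 M17 n_ub.
  have := column_failure_ub C0 kappa0 M17 l1 kl n_ub k_lb (erefl q).
  have := expR_gt0 (M0%:R / 2 : R).
  rewrite -/K => e1 col entry.
  apply: (@le_trans _ _ (expR (- (1 / 2) * M%:R) + K * expR (- (1 / 2) * M%:R))).
    by rewrite addrC lerD.
  by rewrite [leRHS]mulrDl [(1 + K) * _]mulrDl (mul1r (expR _)) lerDl mulr_ge0// ltW.
- move=> w gw eps; apply: good_event_PUN gw _ => //.
  by rewrite subnK.
Qed.
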